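(* For $r,s\in\mathbb N$ such that $s\leq r\neq0$, $1\leq\lambda_1<\cdots<\lambda_s\leq r$, and positive real numbers $a_1,\dots,a_r,b_1,\dots,b_s$ satisfying, for all $1\leq i\leq r$ and $1\leq j\leq s$, $b_j>a_i$ if $i\leq\lambda_j$ and $b_j>a_i-1$ if $i\geq\lambda_j+1$, let $(P_n(x))_{n\in\mathbb N}$ be the $r$-orthogonal polynomial sequence defined by $$P_n(x)=\frac{(-1)^n(a_1)_n\cdots(a_r)_n}{\left(b_1^{(n-1)}\right)_n\cdots\left(b_s^{(n-1)}\right)_n}\;{}_{s+1}F_r\left(\left.\begin{matrix}-n,b_1^{(n-1)},\dots,b_s^{(n-1)}\\ a_1,\dots,a_r\end{matrix}\,\right|\,x\right),\qquad b_j^{(n-1)}=b_j+\left\lceil\frac{n-\lambda_j}{r}\right\rceil.$$ Then, $$\lim_{n\to\infty}\frac{(-1)^n\left(b_1^{(n-1)}\right)_n\cdots\left(b_s^{(n-1)}\right)_n}{(a_1)_n\cdots(a_r)_n}\,P_n\left(\frac z{n^{s+1}}\right)={}_0F_r\left(\left.\begin{matrix}-\\ a_1,\dots,a_r\end{matrix}\,\right|\,-\frac z{r^s}\right)$$ uniformly on compact subsets of $\mathbb C$.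
   Context: $\mathbb N=\{0,1,2,\dots\}$; $(z)_0=1$, $(z)_n=z(z+1)\cdots(z+n-1)$ for $n\ge1$; ${}_pF_q\left(\left.\begin{matrix}c_1,\dots,c_p\\ d_1,\dots,d_q\end{matrix}\,\right|\,x\right)=\sum_{n\ge0}\frac{(c_1)_n\cdots(c_p)_n}{(d_1)_n\cdots(d_q)_n}\frac{x^n}{n!}$, where ''$-$'' denotes an empty list of parameters. *)

(* Defs.v *)
From HB Require Import structures.
From mathcomp Require Import all_boot all_order all_algebra.
From mathcomp Require Import all_classical all_reals all_analysis.
From mathcomp Require Import complex.
Set Implicit Arguments.
Unset Strict Implicit.
Unset Printing Implicit Defensive.
Import Order.TTheory GRing.Theory Num.Theory.
Import numFieldNormedType.Exports.
Local Open Scope classical_set_scope.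
Local Open Scope complex_scope.
Local Open Scope ring_scope.

(* The topology of R[i] is that of its modulus.  The copy stops short of the
   normed-module structure over R[i], because R[i] already carries its
   canonical structure of module over R. *)
HB.instance Definition _ (R : realType) :=
  PseudoMetricNormedZmod.copy R[i] (R[i])^o.

Definition pochhammer (K : pzSemiRingType) (z : K) (n : nat) : K :=
  \prod_(k < n) (z + k%:R).

Section Hypergeometric.
Variable R : realType.

Definition pFq_term (cs ds : seq R[i]) (x : R[i]) (n : nat) : R[i] :=
  (\prod_(c <- cs) pochhammer c n) / (\prod_(d <- ds) pochhammer d n)
    * (x ^+ n / n`!%:R).

(* [limn] is a total operator: the value is the sum of the series whenever the
   series converges. *)
Definition pFq (cs ds : seq R[i]) (x : R[i]) : R[i] :=
  limn (series (pFq_term cs ds x)).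

(* [shifted_param r l b n] is b^(n-1) = b + ceil((n - l) / r); the index is
   shifted by one so that n = 0 is covered without truncated subtraction. *)
Definition shifted_param (r l : nat) (b : R) (n : nat) : R :=
  b + (Num.ceil ((n%:R - l%:R) / r%:R : R))%:~R.

Definition P (r s : nat) (lam : 'I_s -> nat) (a : 'I_r -> R) (b : 'I_s -> R)
    (n : nat) (x : R[i]) : R[i] :=
  (-1) ^+ n * (\prod_(i < r) pochhammer (a i)%:C n)
    / (\prod_(j < s) pochhammer (shifted_param r (lam j) (b j) n)%:C n)
  * pFq (- n%:R :: [seq (shifted_param r (lam j) (b j) n)%:C | j : 'I_s])
        [seq (a i)%:C | i : 'I_r] x.

End Hypergeometric.

(* Main.v *)
(* After the prefactors cancel, the k-th term of the series is z^k / k! times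
   the product over m < k of ((m - n) / n) * prod_j (b_j^(n-1) + m) / n, divided by
   prod_i (a_i)_k.  For fixed m each factor tends to - r^(-s), because b_j^(n-1)
   is n / r up to a bounded error; and the product is at most
   (prod_j (b_j + 3))^k for all k and n, since it vanishes as soon as k > n.
   With (a_i)_k >= a_i^k the series are dominated by an exponential series,
   uniformly for z in a bounded set, so the limit can be taken termwise. *)

Require Import Defs.
From HB Require Import structures.
From mathcomp Require Import all_boot all_order all_algebra.
From mathcomp Require Import all_classical all_reals all_analysis.
From mathcomp Require Import complex ring lra.
Import Order.TTheory GRing.Theory Num.Theory.
Import numFieldNormedType.Exports.
Local Open Scope classical_set_scope.
Local Open Scope complex_scope.
Local Open Scope ring_scope.

(** * Real-valued modulus and convergence in [R[i]] *)

Lemma gt0_complexE (R : rcfType) (e : R[i]) :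
  0 < e -> exists2 d : R, 0 < d & e = d%:C.
Proof.
case: e => x y; rewrite ltcE /= => /andP[/eqP -> x_gt0].
by exists x.
Qed.

Import ComplexField.Normc.

Section Modulus.
Variable R : rcfType.
Implicit Types x y z : R[i].

Lemma normcE z : `|z| = (normc z)%:C.
Proof. by case: z => a b; rewrite normc_def. Qed.

Lemma normc_ge0 z : 0 <= normc z.
Proof. by case: z => a b; exact: sqrtr_ge0. Qed.

Lemma ler_normcD x y : normc (x + y) <= normc x + normc y.
Proof. by rewrite -lecR rmorphD /= -!normcE ler_normD. Qed.

Lemma normc_distC x y : normc (x - y) = normc (y - x).
Proof. by apply: (@complexI R); rewrite -!normcE distrC. Qed.

Lemma ler_normc_distD z x y : normc (x - y) <= normc (x - z) + normc (z - y).
Proof. by have /= := ler_normcD (x - z) (z - y); rewrite addrA subrK. Qed.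

Lemma ler_normc_sum (I : Type) (s : seq I) (F : I -> R[i]) :
  normc (\sum_(i <- s) F i) <= \sum_(i <- s) normc (F i).
Proof.
elim/big_rec2: _ => [|i y x _ le_xy]; first by rewrite normc0.
by apply: le_trans (ler_normcD _ _) _; rewrite lerD2l.
Qed.

Lemma normcR (a : R) : normc a%:C = `|a|.
Proof. by rewrite /= expr0n addr0 sqrtr_sqr. Qed.

Lemma normcX z n : normc (z ^+ n) = normc z ^+ n.
Proof. by elim: n => [|n IHn]; rewrite ?normc1 // !exprS normcM IHn. Qed.

Lemma normc_ge_absRe z : `|complex.Re z| <= normc z.
Proof. by rewrite -lecR -normcE normc_ge_Re. Qed.

Lemma normc_ge_absIm z : `|complex.Im z| <= normc z.
Proof.
by case: z => a b /=; rewrite -sqrtr_sqr ler_wsqrtr // lerDr sqr_ge0.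
Qed.

Lemma ler_normc_ReIm z : normc z <= `|complex.Re z| + `|complex.Im z|.
Proof.
case: z => x y /=.
rewrite -[leRHS]ger0_norm ?addr_ge0 // -[leRHS]sqrtr_sqr.
apply: ler_wsqrtr; rewrite sqrrD !real_normK ?num_real // lerD2r lerDl.
by rewrite mulrn_wge0 ?mulr_ge0.
Qed.

End Modulus.

(** The norm and the radii of balls in [R[i]] are themselves elements of [R[i]], where every
    positive element is real; epsilons can therefore range over [R]. *)
Lemma cvgCdist_lt (R : realType) (T : Type) (F : set_system T) {FF : Filter F}
    (f : T -> R[i]) (l : R[i]) :
  f x @[x --> F] --> l <->
  forall e : R, 0 < e -> \forall x \near F, normc (l - f x) < e.
Proof.
split=> [/cvgrPdist_lt fl e e_gt0|fl].
  have := fl e%:C; rewrite ltcR => /(_ e_gt0); apply: filterS => x.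
  by rewrite -ltcR -normcE.
apply/cvgrPdist_lt => _ /gt0_complexE[e e_gt0 ->]; apply: filterS (fl e e_gt0).
by move=> x; rewrite -ltcR -normcE.
Qed.

Lemma cvg_complex (R : realType) (T : Type) (F : set_system T) {FF : Filter F}
    (f : T -> R[i]) (l : R[i]) :
  complex.Re (f x) @[x --> F] --> complex.Re l ->
  complex.Im (f x) @[x --> F] --> complex.Im l -> f x @[x --> F] --> l.
Proof.
move=> /cvgrPdist_lt fRe /cvgrPdist_lt fIm.
apply/cvgCdist_lt => e e_gt0.
have e2_gt0 : 0 < e / 2 by rewrite divr_gt0.
near=> x; apply: le_lt_trans (ler_normc_ReIm _ _) _.
rewrite [e]splitr !raddfB /= ltrD //; near: x; [exact: fRe|exact: fIm].
Unshelve. all: by end_near. Qed.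

(** * Complex series dominated by a convergent real series *)

Section DominatedSeries.
Variables (R : realType) (u : R[i]^nat) (v : R^nat).
Hypotheses (u_le_v : forall k, normc (u k) <= v k) (v_cvg : cvgn (series v)).

Let v_ge0 k : 0 <= v k.
Proof. exact: le_trans (normc_ge0 _ _) (u_le_v k). Qed.

Let cvg_series_real (f : R[i] -> R) :
  (forall z, `|f z| <= normc z) -> cvgn (series (f \o u)).
Proof.
move=> f_le; apply: normed_cvg; apply: series_le_cvg v_cvg => //= k.
by apply: le_trans (u_le_v k); exact: f_le.
Qed.

(** Real and imaginary parts are bounded by the modulus, so both real series converge absolutely by
    comparison with [v]; the complex limit is assembled from theirs. *)
Lemma dominated_cvg_series : cvgn (series u).
Proof.
have cRe := cvg_series_real _ (@normc_ge_absRe R).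
have cIm := cvg_series_real _ (@normc_ge_absIm R).
apply: (cvgP (limn (series (@complex.Re R \o u)) +i*
              limn (series (@complex.Im R \o u)))%C).
apply: cvg_complex => /=.
- by under eq_fun do rewrite raddf_sum.
- by under eq_fun do rewrite raddf_sum.
Qed.

(** Between [N] and a far index [M] the terms of [u] are bounded by those of [v], whose partial sums
    increase to their limit; what [u] leaves beyond [M] is absorbed in an arbitrary [e]. *)
Lemma dominated_series_tail N :
  normc (limn (series u) - series u N) <= limn (series v) - series v N.
Proof.
apply/ler_addgt0Pr => e e_gt0.
have [M NM dist_lt] : exists2 M, (N <= M)%N &
    normc (limn (series u) - series u M) < e.
  have near_lt := (cvgCdist_lt _ _ _ _ _).1 dominated_cvg_series _ e_gt0.
  near \oo => M; exists M; near: M; [exact: nbhs_infty_ge|exact: near_lt].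
apply: le_trans (ler_normc_distD _ (series u M) _ _) _.
rewrite addrC; apply: lerD (ltW dist_lt).
rewrite sub_series_geq //; apply: le_trans (ler_normc_sum _ _ _ _) _.
apply: le_trans (ler_sum _ (fun k _ => u_le_v k)) _.
rewrite -sub_series_geq // lerD2r.
apply: nondecreasing_cvgn_le => //.
by apply: nondecreasing_series => k _ _; exact: v_ge0.
Unshelve. all: by end_near. Qed.

End DominatedSeries.

(* Tannery's theorem, with the domination and the termwise convergence uniform
   in a parameter. *)
Lemma dominated_series_uniform_cvg (R : realType) (T : Type) (K : set T)
    (u : nat -> T -> R[i]^nat) (w : T -> R[i]^nat) (v : R^nat)
    (d : nat -> R^nat) (e : R) :
  cvgn (series v) -> 0 < e ->
  (\forall n \near \oo, forall z k, K z -> normc (u n z k) <= v k) ->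
  (forall z k, K z -> normc (w z k) <= v k) ->
  (forall n z k, K z -> normc (w z k - u n z k) <= d n k) ->
  (forall k, d n k @[n --> \oo] --> 0) ->
  \forall n \near \oo, forall z, K z ->
    normc (limn (series (w z)) - limn (series (u n z))) < e.
Proof.
move=> v_cvg e_gt0 u_le w_le wu_le d_cvg.
have e3_gt0 : 0 < e / 3 by rewrite divr_gt0.
(* The cutoff [N] depends only on [v] and [e], so one finite head serves every [n] and every [z]. *)
have /cvgrPdist_lt /(_ _ e3_gt0) [N _ /(_ N (leqnn N)) tail_lt] := v_cvg.
have sum_cvg : (\sum_(0 <= k < N) d n k) @[n --> \oo] --> (0 : R).
  rewrite [X in _ --> X](_ : 0 = \sum_(0 <= k < N) 0); last first.
    by rewrite big1_eq.
  by apply: cvg_big => [|k _]; [exact: add_continuous|exact: d_cvg].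
have /cvgrPdist_lt /(_ _ e3_gt0) sum_lt := sum_cvg.
near=> n => z Kz.
have u_le_n k : normc (u n z k) <= v k by move: z k Kz; near: n.
have tail_le (t : R[i]^nat) : (forall k, normc (t k) <= v k) ->
    normc (limn (series t) - series t N) <= e / 3.
  move=> t_le; apply: le_trans (dominated_series_tail _ _ _ t_le v_cvg N) _.
  exact: le_trans (ler_norm _) (ltW tail_lt).
have mid : normc (series (w z) N - series (u n z) N) < e / 3.
  rewrite -sumrB; apply: le_lt_trans (ler_normc_sum _ _ _ _) _.
  apply: le_lt_trans (ler_sum _ (fun k _ => wu_le n z k Kz)) _.
  apply: le_lt_trans (ler_norm _) _.
  by rewrite -normrN -sub0r; near: n.
(* The three thirds are the tail of [w], the difference of the heads, and the tail of [u]. *)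
have -> : e = e / 3 + e / 3 + e / 3.
  by field.
apply: le_lt_trans (ler_normc_distD _ (series (u n z) N) _ _) _.
apply: ltr_leD; last first.
  by rewrite normc_distC; exact: tail_le.
apply: le_lt_trans (ler_normc_distD _ (series (w z) N) _ _) _.
by apply: ler_ltD mid; apply: tail_le => k; exact: w_le.
Unshelve. all: by end_near. Qed.

(** * Boundedness of compact sets *)

Lemma normc_continuous (R : realType) :
  continuous (fun z : R[i] => normc z : R).
Proof.
move=> z; apply: (cvgrPdist_lt (FF := nbhs_filter z) _ _).2 => e e_gt0.
have id_cvg : id y @[y --> z] --> z by [].
have := (@cvgCdist_lt R R[i] (nbhs z) (nbhs_filter z) id z).1 id_cvg _ e_gt0.
apply: filterS => y; apply: le_lt_trans; rewrite ler_norml.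
(* Triangle inequalities with 0 as endpoint yield the reverse triangle inequality. *)
have := ler_normc_distD _ y z 0; have := ler_normc_distD _ z y 0.
rewrite !subr0 (normc_distC _ y z); lra.
Qed.

Lemma compact_normc_bounded (R : realType) (K : set R[i]) :
  compact K -> exists2 B : R, 0 < B & forall z, K z -> normc z <= B.
Proof.
move=> cK; have : compact ((fun z : R[i] => normc z : R) @` K).
  by apply: continuous_compact cK; apply/continuous_subspaceT/normc_continuous.
move=> /compact_bounded /pinfty_ex_gt0[B B_gt0 KB]; exists B => // z Kz.
by apply: le_trans (ler_norm _) _; apply: KB; exists z.
Qed.

(** * Pochhammer symbols and growth of the shifted parameters *)

Lemma pochhammer_rmorph (K L : pzSemiRingType) (f : {rmorphism K -> L})
    (x : K) k : f (pochhammer x k) = pochhammer (f x) k.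
Proof.
by rewrite rmorph_prod; apply: eq_bigr => m _; rewrite rmorphD rmorph_nat.
Qed.

Lemma ler_expr_pochhammer (R : realFieldType) (x : R) k :
  0 <= x -> x ^+ k <= pochhammer x k.
Proof.
move=> x_ge0; rewrite -[k in x ^+ k]card_ord -prodr_const.
by apply: ler_prod => m _; rewrite x_ge0 lerDl ler0n.
Qed.

Lemma pochhammer_gt0 (R : realFieldType) (x : R) k :
  0 < x -> 0 < pochhammer x k.
Proof. by move=> x_gt0; apply: prodr_gt0 => m _; rewrite ltr_wpDr ?ler0n. Qed.

Section ShiftedParam.
Variables (R : realType) (r l : nat) (b : R).
Hypotheses (r_gt0 : (0 < r)%N) (l_le_r : (l <= r)%N) (b_gt0 : 0 < b).

Let rR_gt0 : 0 < r%:R :> R. Proof. by rewrite ltr0n. Qed.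
Let lr_le1 : l%:R / r%:R <= 1 :> R.
Proof. by rewrite ler_pdivrMr // mul1r ler_nat. Qed.
Let lr_ge0 : 0 <= l%:R / r%:R :> R. Proof. by rewrite divr_ge0. Qed.

(** Since [l <= r], a positive [n] gives [(n - l) / r > -1], so the ceiling is at least 0. At
    [n = 0] and [l = r] the ceiling is -1 and positivity can fail. *)
Lemma shifted_param_gt0 n : (0 < n)%N -> 0 < shifted_param r l b n.
Proof.
move=> n_gt0; apply: ltr_pwDl => //; rewrite ler0z ceil_ge0.
have : 0 < n%:R / r%:R :> R by rewrite divr_gt0 ?ltr0n.
by rewrite mulrBl; move: lr_le1; lra.
Qed.

Lemma shifted_param_dist n :
  `|shifted_param r l b n - n%:R / r%:R| <= b + 1.
Proof.
rewrite /shifted_param mulrBl ler_norml.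
have := ceil_itv (n%:R / r%:R - l%:R / r%:R : R).
move=> /andP[]; rewrite intrB; move: lr_le1 lr_ge0 b_gt0; lra.
Qed.

Lemma shifted_param_cvg (x : R) :
  (shifted_param r l b n + x) / n%:R @[n --> \oo] --> (r%:R^-1 : R).
Proof.
(* [C] bounds [n] times the distance to the limit, so [n > C / e] suffices. *)
apply/cvgrPdist_lt => e e_gt0; pose C := b + 1 + `|x|.
have C_gt0 : 0 < C by rewrite ltr_wpDr // addr_gt0.
near=> n.
have n_gt : C / e < n%:R by near: n; exact: nbhs_infty_gtr.
have n_gt0 : 0 < n%:R :> R by apply: lt_trans n_gt; rewrite divr_gt0.
have -> : r%:R^-1 - (shifted_param r l b n + x) / n%:R =
    - ((shifted_param r l b n - n%:R / r%:R) + x) / n%:R.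
  by field; rewrite !gt_eqF.
rewrite normrM normrN normfV (gtr0_norm n_gt0) ltr_pdivrMr //.
apply: le_lt_trans (ler_normD _ _) _; rewrite [e * _]mulrC -ltr_pdivrMr //.
apply: le_lt_trans n_gt; rewrite ler_pM2r ?invr_gt0 // lerD2r.
exact: shifted_param_dist.
Unshelve. all: by end_near. Qed.

(** The numerator is at most [n / r + (b + 1) + m]; each of [n / r] and [m] is at most [n], and
    [b + 1 <= (b + 1) * n], whence 1 + (b + 1) + 1. *)
Lemma shifted_param_ratio_le n m : (m <= n)%N -> (0 < n)%N ->
  0 <= (shifted_param r l b n + m%:R) / n%:R <= b + 3.
Proof.
move=> le_mn n_gt0; have nR_ge1 : 1 <= n%:R :> R by rewrite ler1n.
have mR_le : m%:R <= n%:R :> R by rewrite ler_nat.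
have nr_le : n%:R / r%:R <= n%:R :> R.
  by rewrite ler_pdivrMr // ler_peMr ?ler1n.
have := shifted_param_dist n; rewrite ler_norml => /andP[_ sh_le].
have := shifted_param_gt0 _ n_gt0 => sh_gt0.
apply/andP; split.
  by apply: divr_ge0 => //; apply: addr_ge0 => //; exact: ltW.
have bn_ge : b <= b * n%:R by rewrite ler_peMr // ltW.
by rewrite ler_pdivrMr ?ltr0n // mulrDl; lra.
Qed.

End ShiftedParam.

(** * Coefficients of the rescaled polynomials: limits and bounds *)

Section ScaledCoefficients.
Variables (R : realType) (r s : nat) (lam : 'I_s -> nat).
Variables (a : 'I_r -> R) (b : 'I_s -> R).
Hypotheses (r_gt0 : (0 < r)%N) (lam_le_r : forall j, (lam j <= r)%N).
Hypotheses (a_gt0 : forall i, 0 < a i) (b_gt0 : forall j, 0 < b j).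

Let sh j n : R := shifted_param r (lam j) (b j) n.

(* [coef_factor n m] is the quotient, apart from its [a] and [m.+1] factors, of
   the consecutive coefficients of index [m.+1] and [m] of [P n] rescaled by
   [n ^ s.+1]. *)
Definition coef_factor (n m : nat) : R :=
  (m%:R - n%:R) / n%:R * \prod_(j < s) ((sh j n + m%:R) / n%:R).

Definition scaled_coef (n k : nat) : R :=
  (\prod_(m < k) coef_factor n m) / \prod_(i < r) pochhammer (a i) k.

Definition limit_coef (k : nat) : R :=
  (- r%:R ^- s) ^+ k / \prod_(i < r) pochhammer (a i) k.

Lemma prod_pochhammer_gt0 k : 0 < \prod_(i < r) pochhammer (a i) k.
Proof. by apply: prodr_gt0 => i _; exact: pochhammer_gt0. Qed.

Lemma prod_pochhammer_complex k :
  (\prod_(i < r) pochhammer (a i) k)%:C =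
  \prod_(i < r) pochhammer (a i)%:C k :> R[i].
Proof.
by rewrite rmorph_prod; apply: eq_bigr => i _; exact: pochhammer_rmorph.
Qed.

Lemma pFq_term_scaled n k (z : R[i]) :
  pFq_term (- n%:R :: [seq (sh j n)%:C | j : 'I_s]) [seq (a i)%:C | i : 'I_r]
    (z / n%:R ^+ s.+1) k = (scaled_coef n k)%:C * (z ^+ k / k`!%:R).
Proof.
rewrite /pFq_term big_cons !big_image /= expr_div_n.
rewrite /scaled_coef fmorph_div /= prod_pochhammer_complex.
suff -> : (\prod_(m < k) coef_factor n m)%:C =
    pochhammer (- n%:R) k * (\prod_(j < s) pochhammer (sh j n)%:C k) /
    (n%:R ^+ s.+1) ^+ k :> R[i].
  by ring.
rewrite /pochhammer exchange_big /= -big_split /= rmorph_prod.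
rewrite -[k in _ / _ ^+ k]card_ord -prodr_const -prodf_div /=.
apply: eq_bigr => m _; rewrite /coef_factor rmorphM fmorph_div rmorph_prod /=.
(* Of the [s.+1] powers of [n] available for each [m], one goes to [m - n] and one to each of the
   [s] shifted parameters. *)
rewrite rmorphB !rmorph_nat exprS invfM mulrACA; congr (_ * _).
  by rewrite addrC.
rewrite -[s in _ / _ ^+ s]card_ord -prodr_const -prodf_div /=.
by apply: eq_bigr => j _; rewrite fmorph_div rmorphD !rmorph_nat.
Qed.

Lemma pFq_term_limit k (z : R[i]) :
  pFq_term [::] [seq (a i)%:C | i : 'I_r] (- (z / r%:R ^+ s)) k =
  (limit_coef k)%:C * (z ^+ k / k`!%:R).
Proof.
rewrite /pFq_term big_nil big_image /= /limit_coef fmorph_div /=.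
rewrite prod_pochhammer_complex rmorphXn rmorphN /= fmorphV rmorphXn rmorph_nat.
by rewrite mulrC -mulrN exprMn; ring.
Qed.

Lemma coef_factor_cvg m :
  coef_factor n m @[n --> \oo] --> (- r%:R ^- s : R).
Proof.
rewrite -mulN1r; apply: cvgM.
  apply/cvgrPdist_lt => e e_gt0; near=> n.
  have n_gt : m%:R / e < n%:R by near: n; exact: nbhs_infty_gtr.
  have n_gt0 : 0 < n%:R :> R 
    by apply: le_lt_trans n_gt; rewrite divr_ge0 // ltW.
  have -> : -1 - (m%:R - n%:R) / n%:R = - (m%:R / n%:R) :> R.
    by field; rewrite gt_eqF.
  rewrite normrN ger0_norm ?divr_ge0 ?(ltW n_gt0) // ltr_pdivrMr // mulrC.
  by rewrite -ltr_pdivrMr.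
rewrite -exprVn -[s in X in _ --> X]card_ord -prodr_const.
apply: cvg_big => [|j _]; first exact: mul_continuous.
exact: shifted_param_cvg.
Unshelve. all: by end_near. Qed.

Lemma scaled_coef_cvg k : scaled_coef n k @[n --> \oo] --> (limit_coef k : R).
Proof.
apply: cvgM; last exact: cvg_cst.
rewrite -[k in X in _ --> X]card_ord -prodr_const.
apply: cvg_big => [|m _]; first exact: mul_continuous.
exact: coef_factor_cvg.
Qed.

(** [D] bounds the modulus of [coef_factor n m] for [m <= n] and [n > 0], and [A ^+ k] bounds the
    denominators from below. *)
Let D := \prod_(j < s) (b j + 3).
Let A := \prod_(i < r) a i.

Lemma coef_le (x : R) k : `|x| <= D ^+ k ->
  `|x / \prod_(i < r) pochhammer (a i) k| <= (D / A) ^+ k.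
Proof.
move=> x_le; rewrite normrM normfV (gtr0_norm (prod_pochhammer_gt0 k)).
rewrite expr_div_n ler_pM ?invr_ge0 ?(ltW (prod_pochhammer_gt0 k)) //.
have A_gt0 : 0 < A by exact: prodr_gt0.
rewrite lef_pV2 ?posrE ?exprn_gt0 ?prod_pochhammer_gt0 // -prodrXl.
by apply: ler_prod => i _; rewrite exprn_ge0 ?ler_expr_pochhammer ?ltW.
Qed.

Lemma limit_coef_le k : `|limit_coef k| <= (D / A) ^+ k.
Proof.
apply: coef_le; rewrite normrX lerXn2r ?nnegrE //.
  by apply: prodr_ge0 => j _; rewrite addr_ge0 // ltW.
rewrite normrN normfV normrX normr_nat -exprVn -[s in X in X <= _]card_ord.
rewrite -prodr_const; apply: ler_prod => j _; rewrite invr_ge0 ler0n /=.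
(* Here [D] is far from sharp: [r^-1 <= 1 <= b j + 3]. *)
apply: (@le_trans _ _ 1); last by move: (b_gt0 j); lra.
by rewrite invf_le1 ?ltr0n // ler1n.
Qed.

Lemma scaled_coef_le n k : (0 < n)%N -> `|scaled_coef n k| <= (D / A) ^+ k.
Proof.
move=> n_gt0; apply: coef_le; rewrite normr_prod.
have [le_kn|lt_nk] := leqP k n; last first.
  (* For [k > n] the factor of index [n] contains [n - n]: the series terminates. *)
  rewrite (bigD1 (Ordinal lt_nk)) //= /coef_factor subrr !mul0r normr0 mul0r.
  by apply: exprn_ge0; apply: prodr_ge0 => j _; rewrite addr_ge0 // ltW.
rewrite -[k in leRHS]card_ord -prodr_const; apply: ler_prod => m _.
have le_mn : (m <= n)%N by apply: leq_trans le_kn; exact: ltnW.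
have nR_gt0 : 0 < n%:R :> R by rewrite ltr0n.
rewrite normr_ge0 normrM -[leRHS]mul1r normr_prod /=; apply: ler_pM => //.
- exact: prodr_ge0.
- rewrite normrM normfV normr_nat ler_pdivrMr // mul1r distrC.
  by rewrite ger0_norm ?subr_ge0 ?ler_nat // gerBl.
- apply: ler_prod => j _; rewrite normr_ge0 /=.
  have /andP[? ?] :=
    shifted_param_ratio_le _ _ _ _ r_gt0 (lam_le_r j) (b_gt0 j) n m le_mn n_gt0.
  by rewrite ger0_norm.
Qed.

End ScaledCoefficients.

(** * Uniform convergence on compact sets *)

Theorem proposition8p3 (R : realType) (r s : nat) (lam : 'I_s -> nat)
    (a : 'I_r -> R) (b : 'I_s -> R)
    (s_le_r : (s <= r)%N) (r_neq0 : r <> 0%N)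
    (lam_ge1 : forall j : 'I_s, (1 <= lam j)%N)
    (lam_le_r : forall j : 'I_s, (lam j <= r)%N)
    (lam_incr : forall j k : 'I_s, (j < k)%N -> (lam j < lam k)%N)
    (a_gt0 : forall i : 'I_r, 0 < a i)
    (b_gt0 : forall j : 'I_s, 0 < b j)
    (* [i : 'I_r] counts from 0, so the index of a_i in the 1-based numbering
       used by lam is [i.+1] *)
    (b_gt_a : forall (i : 'I_r) (j : 'I_s), (i.+1 <= lam j)%N -> a i < b j)
    (b_gt_a1 : forall (i : 'I_r) (j : 'I_s),
      (lam j + 1 <= i.+1)%N -> a i - 1 < b j) :
  {family compact,
    (fun (n : nat) (z : R[i]) =>
       (-1) ^+ n
         * (\prod_(j < s) pochhammer (shifted_param r (lam j) (b j) n)%:C n)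
         / (\prod_(i < r) pochhammer (a i)%:C n)
       * P lam a b n (z / n%:R ^+ s.+1)) @ \oo
    --> (fun z : R[i] =>
           pFq [::] [seq (a i)%:C | i : 'I_r] (- (z / r%:R ^+ s)))}.
Proof.
have r_gt0 : (0 < r)%N by rewrite lt0n; apply/eqP.
apply/fam_cvgP => K cK W /uniform_nbhs[E [entE EW]].
(* The target entourage contains all pairs at distance less than some radius, which is real. *)
move: entE; rewrite -entourage_ballE => -[_ /gt0_complexE[e e_gt0 ->] ballE].
have [B B_gt0 KB] := compact_normc_bounded _ _ cK.
pose t (z : R[i]) k : R[i] := z ^+ k / k`!%:R.
pose C := (\prod_(j < s) (b j + 3)) / \prod_(i < r) a i.
have t_le z k : K z -> normc (t z k) <= B ^+ k / k`!%:R.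
  move=> Kz; rewrite normcM normcX normcV -(rmorph_nat (real_complex R)) normcR.
  rewrite normr_nat ler_wpM2r // lerXn2r ?nnegrE ?normc_ge0 ?(ltW B_gt0) ?KB //.
have coef_t_le z k (x : R) : K z -> `|x| <= C ^+ k ->
    normc (x%:C * t z k) <= exp_coeff (C * B) k.
  move=> Kz x_le; rewrite normcM normcR /exp_coeff /= exprMn -mulrA.
  by apply: ler_pM => //; [exact: normc_ge0|exact: t_le].
(* The dominating series is that of the exponential at [C * B]. The termwise error is uniform on [K]
   because [z] enters only through [t z k], bounded by [B ^+ k / k!]. *)
have unif := @dominated_series_uniform_cvg R R[i] K
  (fun n z k => (scaled_coef R r s lam a b n k)%:C * t z k)
  (fun z k => (limit_coef R r s a k)%:C * t z k) (exp_coeff (C * B))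
  (fun n k => `|limit_coef R r s a k - scaled_coef R r s lam a b n k|
              * (B ^+ k / k`!%:R)) e.
have : \forall n \near \oo, forall z, K z -> normc
    (limn (series (fun k => (limit_coef R r s a k)%:C * t z k)) -
     limn (series (fun k => (scaled_coef R r s lam a b n k)%:C * t z k))) < e.
  apply: unif => //.
  - exact: is_cvg_series_exp_coeff.
  - near=> n; move=> z k Kz; apply: coef_t_le => //.
    apply: scaled_coef_le => //.
    by near: n; exact: nbhs_infty_gt.
  - by move=> z k Kz; apply: coef_t_le => //; exact: limit_coef_le.
  - move=> n z k Kz; rewrite -mulrBl -rmorphB normcM normcR.
    by rewrite ler_wpM2l // t_le.
  - move=> k; rewrite -[X in _ --> X](mul0r (B ^+ k / k`!%:R)).
    apply: cvgM; last exact: cvg_cst.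
    rewrite -[X in _ --> X](normr0 R); apply: cvg_norm.
    rewrite -[X in _ --> X](subrr (limit_coef R r s a k)).
    by apply: cvgB; [exact: cvg_cst|exact: scaled_coef_cvg].
move=> unif_e; apply: (filterS EW).
apply: filterS2 (nbhs_infty_gt 0) unif_e => n n_gt0 dist_lt z Kz; apply: ballE.
rewrite -ball_normE /= normcE ltcR.
set Bn := \prod_(j < s) _; set An := \prod_(i < r) _.
have An_neq0 : An != 0.
  rewrite /An -prod_pochhammer_complex fmorph_eq0 gt_eqF //.
  exact: prod_pochhammer_gt0.
(* Positivity of [n] makes every shifted parameter positive, which allows [Bn] to be cancelled. *)
have Bn_neq0 : Bn != 0.
  rewrite /Bn -prod_pochhammer_complex fmorph_eq0 gt_eqF //.
  by apply: prod_pochhammer_gt0 => j; exact: shifted_param_gt0.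
have -> : (-1) ^+ n * Bn / An * P lam a b n (z / n%:R ^+ s.+1) =
    limn (series (fun k => (scaled_coef R r s lam a b n k)%:C * t z k)).
  rewrite /P -/An -/Bn /pFq.
  set F1 := pFq_term _ _ _.
  have -> : F1 = (fun k => (scaled_coef R r s lam a b n k)%:C * t z k).
    by apply/funext => k; exact: pFq_term_scaled.
  (* [Bn / An] cancels the [An / Bn] inside [P], leaving only the two signs. *)
  set X := limn _; transitivity ((-1) ^+ n * (-1) ^+ n * X).
    by field; apply/andP.
  by rewrite -expr2 sqrr_sign mul1r.
rewrite /pFq; set F2 := pFq_term _ _ _.
have -> : F2 = (fun k => (limit_coef R r s a k)%:C * t z k).
  by apply/funext => k; exact: pFq_term_limit.
exact: dist_lt.
Unshelve. all: by end_near. Qed.
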